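(* Let $H$ be a Hopf algebra over a field $\Bbbk$ with bijective antipode and let $(A,\rho_A)$ be a right $H$-comodule algebra. Let $\mathrm{Casim}(H,\psi)$ be the set of Casimir morphisms for $(H,\psi)$ and $\int_{(H,\psi)}$ the set of integrals on $(H,\psi)$. Then $$\Phi:\mathrm{Casim}(H,\psi)\longrightarrow \textstyle\int_{(H,\psi)},\qquad \Phi(B)(h):=B(h\otimes 1_H)\quad (h\in H),$$ is a (well-defined) bijective map. Moreover, $\Phi$ induces a bijective correspondence between the set $\mathrm{Casim_{norm}}(H,\psi)$ of normalized Casimir morphisms for $(H,\psi)$ and the set $\int^{\mathrm{tot}}_{(H,\psi)}$ of total integrals on $(H,\psi)$.
   Context: Everything is over a field $\Bbbk$, $\otimes=\otimes_{\Bbbk}$, and Sweedler notation with suppressed summation is used. $H$ is a Hopf algebra with counit $\varepsilon$ and antipode $S$; $H^{\mathrm{op}}$ is $H$ with opposite multiplication. A right $H$-comodule algebra $(A,\rho_A)$ is a unital associative algebra $A$ which is a right $H$-comodule via an algebra map $\rho_A:A\to A\otimes H$, $\rho_A(a)=a_0\otimes a_1$ (iterated: $a_0\otimes a_1\otimes a_2$, etc.). With $\psi:H\otimes A\otimes H^{\mathrm{op}}\to A\otimes H^{\mathrm{op}}\otimes H$, $\psi(h\otimes a\otimes l)=a_0\otimes l_1\otimes l_2ha_1$, one has a cowreath $(A\otimes H^{\mathrm{op}},H,\psi)$. Convention: whenever a multiplication symbol is omitted, products in $A\otimes H$ are computed with the ordinary multiplications of $A$ and of $H$ (not the opposite one).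 A Casimir morphism for $(H,\psi)$ is a $\Bbbk$-linear map $B:H\otimes H\to A\otimes H^{\mathrm{op}}$, written $B(h\otimes h')=B^A(h\otimes h')\otimes B^H(h\otimes h')$, such that for all $a\in A$, $g,h,h'\in H$: $$(a_0\otimes 1_H)B(g_2ha_1\otimes g_3h'a_2)(1_A\otimes g_1)=(1_A\otimes g)B(h\otimes h')(a\otimes 1_H),$$ $$B^A(h_2\otimes h')_0\otimes B^H(h_2\otimes h')_1\otimes B^H(h_2\otimes h')_2h_1B^A(h_2\otimes h')_1=B(h\otimes h'_1)\otimes h'_2.$$ It is normalized if $B(h_1\otimes h_2)=\varepsilon(h)1_A\otimes 1_H$ for all $h\in H$. An integral on $(H,\psi)$ is a $\Bbbk$-linear map $\mathfrak{T}:H\to A\otimes H^{\mathrm{op}}$, written $\mathfrak{T}(h)=\mathfrak{T}^A(h)\otimes \mathfrak{T}^H(h)$, such that for all $a\in A$, $h\in H$: $$\mathfrak{T}^A(h_2)_0\otimes \mathfrak{T}^H(h_2)_1\otimes \mathfrak{T}^H(h_2)_2h_1\mathfrak{T}^A(h_2)_1=\mathfrak{T}(h)\otimes 1_H,$$ $$(a_0\otimes 1_H)\mathfrak{T}(S^{-1}(a_2)ha_1)(1_A\otimes S^{-1}(a_3))=(1_A\otimes S^{-1}(a_1))\mathfrak{T}(h)(a_0\otimes 1_H).$$ It is total if $\mathfrak{T}(1_H)=1_A\otimes 1_H$. *)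

(* Defs.v *)
From HB Require Import structures.
From mathcomp Require Import all_boot all_order all_algebra.
From mathcomp Require Import boolp classical_sets functions.
Import GRing.Theory.

Set Implicit Arguments.
Unset Strict Implicit.
Unset Printing Implicit Defensive.

Local Open Scope ring_scope.
Local Open Scope quotient_scope.


(* "⊗" binds more loosely than "*" and more tightly than "+", so that
   [a0 ⊗ l2 * h * a1] is [a0 ⊗ (l2 * h * a1)]. *)
Reserved Notation "x ⊗ y" (at level 45, left associativity).
Reserved Notation "\sw_( u ⊗ v <- x ) F"
  (at level 41, u name, v name, x at level 45, F at level 45,
   format "\sw_( u  ⊗  v  <-  x )  F").

Section Tensor.
Variables (k : fieldType) (V W : lmodType k).

(* V ⊗ W is the set of formal sums of pairs (v, w), represented by sequences,
   modulo the congruence generated by commutativity and bilinearity. *)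
Inductive tens_eq : seq (V * W) -> seq (V * W) -> Prop :=
| tens_eq_refl s : tens_eq s s
| tens_eq_sym s t : tens_eq s t -> tens_eq t s
| tens_eq_trans s t u : tens_eq s t -> tens_eq t u -> tens_eq s u
| tens_eq_cat s s' t t' :
    tens_eq s s' -> tens_eq t t' -> tens_eq (s ++ t) (s' ++ t')
| tens_eq_catC s t : tens_eq (s ++ t) (t ++ s)
| tens_eq_0l w : tens_eq [:: (0, w)] [::]
| tens_eq_Dl v v' w : tens_eq [:: (v + v', w)] [:: (v, w); (v', w)]
| tens_eq_Dr v w w' : tens_eq [:: (v, w + w')] [:: (v, w); (v, w')]
| tens_eq_Z c v w : tens_eq [:: (c *: v, w)] [:: (v, c *: w)].

Definition tens_eqb : rel (seq (V * W)) := fun s t => `[< tens_eq s t >].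

Lemma tens_eqb_refl : reflexive tens_eqb.
Proof. by move=> s; apply/asboolP; apply: tens_eq_refl. Qed.

Lemma tens_eqb_sym : symmetric tens_eqb.
Proof. by move=> s t; apply/asboolP/asboolP; apply: tens_eq_sym. Qed.

Lemma tens_eqb_trans : transitive tens_eqb.
Proof.
by move=> t s u /asboolP st /asboolP tu; apply/asboolP; apply: tens_eq_trans tu.
Qed.

Canonical tens_equiv := EquivRel tens_eqb tens_eqb_refl tens_eqb_sym
  tens_eqb_trans.

Definition tensor := {eq_quot tens_eqb}.

HB.instance Definition _ := Choice.on tensor.
HB.instance Definition _ := EqQuotient.on tensor.

Lemma tensP s t : reflect (tens_eq s t) (\pi_tensor s == \pi_tensor t).
Proof. by rewrite piE; apply: asboolP. Qed.

Lemma tensW (P : tensor -> Prop) :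
  (forall s, P (\pi_tensor s)) -> forall x, P x.
Proof. by move=> Ps x; rewrite -[x]reprK. Qed.

Lemma tens_pi s t : tens_eq s t -> \pi_tensor s = \pi_tensor t.
Proof. by move=> st; apply/eqP/tensP. Qed.

Lemma tens_repr s : tens_eq (repr (\pi_tensor s)) s.
Proof. by apply/tensP; rewrite reprK. Qed.

Definition seq_scale (c : k) (s : seq (V * W)) : seq (V * W) :=
  [seq (c *: p.1, p.2) | p <- s].

Lemma seq_scale_eq c s t : tens_eq s t -> tens_eq (seq_scale c s) (seq_scale c t).
Proof.
elim=> {s t} [s|s t _|s t u _ IH1 _|s s' t t' _ IH1 _ IH2|s t|w|v v' w|v w w'|d v w].
- exact: tens_eq_refl.
- exact: tens_eq_sym.
- exact: tens_eq_trans.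
- by rewrite /seq_scale !map_cat; apply: tens_eq_cat.
- by rewrite /seq_scale !map_cat; apply: tens_eq_catC.
- by rewrite /= scaler0; apply: tens_eq_0l.
- by rewrite /= scalerDr; apply: tens_eq_Dl.
- exact: tens_eq_Dr.
- by rewrite /= scalerA mulrC -scalerA; apply: tens_eq_Z.
Qed.

Definition tens_zero : tensor := \pi_tensor [::].
Definition tens_add (x y : tensor) : tensor := \pi_tensor (repr x ++ repr y).
Definition tens_scale (c : k) (x : tensor) : tensor := \pi_tensor (seq_scale c (repr x)).
Definition tens_opp (x : tensor) : tensor := tens_scale (-1) x.

Lemma tens_addE s t :
  tens_add (\pi_tensor s) (\pi_tensor t) = \pi_tensor (s ++ t).
Proof. by apply/tens_pi/tens_eq_cat; apply: tens_repr. Qed.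

Lemma tens_scaleE c s :
  tens_scale c (\pi_tensor s) = \pi_tensor (seq_scale c s).
Proof. by apply/tens_pi/seq_scale_eq/tens_repr. Qed.

Lemma tens_addA : associative tens_add.
Proof.
move=> x y z; elim/tensW: x => s; elim/tensW: y => t; elim/tensW: z => u.
by rewrite !tens_addE catA.
Qed.

Lemma tens_addC : commutative tens_add.
Proof.
by move=> x y; elim/tensW: x => s; elim/tensW: y => t; rewrite !tens_addE; apply/tens_pi/tens_eq_catC.
Qed.

Lemma tens_add0 : left_id tens_zero tens_add.
Proof. by move=> x; elim/tensW: x => s; rewrite tens_addE. Qed.

Lemma seq_scaleDl a b s :
  tens_eq (seq_scale (a + b) s) (seq_scale a s ++ seq_scale b s).
Proof.
elim: s => [|[v w] s IH] /=; first exact: tens_eq_refl.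
rewrite scalerDl -cat1s; apply: tens_eq_trans.
  by apply: tens_eq_cat; [apply: tens_eq_Dl|apply: IH].
rewrite -[_ :: seq_scale a s ++ _]cat1s -[_ :: seq_scale b s]cat1s.
rewrite -[[:: _; _]]/([:: _] ++ [:: _]) -!catA.
apply: tens_eq_cat; first exact: tens_eq_refl.
rewrite !catA; apply: tens_eq_cat; last exact: tens_eq_refl.
exact: tens_eq_catC.
Qed.

Lemma seq_scale0 s : tens_eq (seq_scale 0 s) [::].
Proof.
elim: s => [|[v w] s IH] /=; first exact: tens_eq_refl.
rewrite scale0r -cat1s -[X in tens_eq _ X]cats0.
by apply: tens_eq_cat => //; apply: tens_eq_0l.
Qed.

Lemma seq_scale1 s : seq_scale 1 s = s.
Proof. by elim: s => [|[v w] s IH] //=; rewrite scale1r IH. Qed.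

Lemma tens_addN : left_inverse tens_zero tens_opp tens_add.
Proof.
move=> x; elim/tensW: x => s; rewrite /tens_opp tens_scaleE tens_addE; apply: tens_pi.
rewrite -{2}[s]seq_scale1; apply: tens_eq_trans (seq_scale0 s).
by apply: tens_eq_sym; rewrite -{1}(addNr 1); apply: seq_scaleDl.
Qed.

HB.instance Definition _ := GRing.isZmodule.Build tensor
  tens_addA tens_addC tens_add0 tens_addN.

Lemma pi_cat s t : \pi_tensor (s ++ t) = \pi_tensor s + \pi_tensor t.
Proof. by rewrite -tens_addE. Qed.

Lemma tens_scaleA a b v : tens_scale a (tens_scale b v) = tens_scale (a * b) v.
Proof.
elim/tensW: v => s; rewrite !tens_scaleE /seq_scale -map_comp; congr (\pi_tensor _).
by apply: eq_map => p /=; rewrite scalerA.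
Qed.

Lemma tens_scale1 : left_id 1 tens_scale.
Proof. by move=> x; elim/tensW: x => s; rewrite tens_scaleE seq_scale1. Qed.

Lemma tens_scaleDr : right_distributive tens_scale +%R.
Proof.
move=> c x y; elim/tensW: x => s; elim/tensW: y => t.
by rewrite -pi_cat !tens_scaleE -pi_cat /seq_scale map_cat.
Qed.

Lemma tens_scaleDl v : {morph tens_scale^~ v : a b / a + b}.
Proof.
elim/tensW: v => s a b; rewrite !tens_scaleE -pi_cat.
exact/tens_pi/seq_scaleDl.
Qed.

HB.instance Definition _ := GRing.Zmodule_isLmodule.Build k tensor
  tens_scaleA tens_scale1 tens_scaleDr tens_scaleDl.

Lemma pi_scale c s : c *: \pi_tensor s = \pi_tensor (seq_scale c s).
Proof. by rewrite -tens_scaleE. Qed.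

Definition pure (v : V) (w : W) : tensor := \pi_tensor [:: (v, w)].

Lemma pure_bilinear : bilinear_for *:%R *:%R pure.
Proof.
split=> [w c v v'|v c w w']; rewrite /= /pure pi_scale -pi_cat /=.
  exact/tens_pi/tens_eq_Dl.
apply: tens_pi; apply: tens_eq_trans; first exact: tens_eq_Dr.
rewrite -[X in tens_eq X _]/([:: _] ++ [:: _]) -[X in tens_eq _ X]/([:: _] ++ [:: _]).
apply: tens_eq_cat; last exact: tens_eq_refl.
exact/tens_eq_sym/tens_eq_Z.
Qed.

HB.instance Definition _ :=
  bilinear_isBilinear.Build k V W tensor _ _ pure pure_bilinear.

(* Sweedler notation: if x = \sum_i v_i ⊗ w_i, then [sweedler x f] is
   \sum_i f v_i w_i.  The sum is taken over a fixed expression of x as a sum of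
   pure tensors; the choice of expression does not matter when f is bilinear
   ([sweedler_pi]), and then [sweedler^~ f] is the linear map on V ⊗ W induced
   by f ([sweedler_linear], [sweedler_pure]). *)
Definition sweedler (U : nmodType) (x : tensor) (f : V -> W -> U) : U :=
  \sum_(p <- repr x) f p.1 p.2.

Lemma tensor_sum x : x = sweedler x pure.
Proof.
rewrite -{1}[x]reprK /sweedler; elim: (repr x) => [|[v w] s IH].
  by rewrite big_nil.
by rewrite big_cons -IH -cat1s pi_cat.
Qed.

Section Lift.
Variables (U : lmodType k) (f : V -> W -> U).
Hypothesis f_bilin : bilinear_for *:%R *:%R f.

Lemma sum_tens_eq s t : tens_eq s t ->
  \sum_(p <- s) f p.1 p.2 = \sum_(p <- t) f p.1 p.2.
Proof.
case: f_bilin => fl fr.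
have flD w v v' : f (v + v') w = f v w + f v' w.
  by have := fl w 1 v v'; rewrite /= !scale1r.
have frD v w w' : f v (w + w') = f v w + f v w'.
  by have := fr v 1 w w'; rewrite /= !scale1r.
have f0 w : f 0 w = 0 by apply: (addIr (f 0 w)); rewrite -flD !add0r.
have f0r v : f v 0 = 0 by apply: (addIr (f v 0)); rewrite -frD !add0r.
elim=> {s t} [s|s t _|s t u _ IH1 _|s s' t t' _ IH1 _ IH2|s t|w|v v' w|v w w'|d v w].
- by [].
- by [].
- by rewrite IH1.
- by rewrite !big_cat /= IH1 IH2.
- by rewrite !big_cat /= addrC.
- by rewrite big_seq1 big_nil f0.
- by rewrite big_seq1 big_cons big_seq1 flD.
- by rewrite big_seq1 big_cons big_seq1 frD.
- rewrite !big_seq1 /=; have := fl w d v 0; have := fr v d w 0.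
  by rewrite /= !addr0 f0 f0r !addr0 => -> ->.
Qed.

Lemma sweedler_pi s : sweedler (\pi_tensor s) f = \sum_(p <- s) f p.1 p.2.
Proof. exact/sum_tens_eq/tens_repr. Qed.

Lemma sweedler_pure v w : sweedler (pure v w) f = f v w.
Proof. by rewrite sweedler_pi big_seq1. Qed.

Lemma sweedler_linear : linear (fun x => sweedler x f).
Proof.
move=> c x y; elim/tensW: x => s; elim/tensW: y => t.
rewrite pi_scale -pi_cat !sweedler_pi big_cat /=.
congr (_ + _); rewrite big_map scaler_sumr; apply: eq_bigr => p _ /=.
have f0 w : f 0 w = 0.
  apply: (addIr (f 0 w)); rewrite add0r; have := f_bilin.1 w 1 0 0.
  by rewrite /= !scale1r addr0 => /esym.
by have := f_bilin.1 p.2 c p.1 0; rewrite /= !addr0 f0 addr0.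
Qed.

End Lift.

Lemma eq_sweedler (U : nmodType) (f g : V -> W -> U) x :
  f =2 g -> sweedler x f = sweedler x g.
Proof. by move=> fg; apply: eq_bigr => p _; apply: fg. Qed.

Lemma tensor_ext (U : lmodType k) (f g : tensor -> U) :
  linear f -> linear g -> (forall v w, f (pure v w) = g (pure v w)) -> f =1 g.
Proof.
move=> lf lg fg x.
have f0 : f 0 = 0 by rewrite -{1}[0](subrr 0) (zmod_morphism_linear lf) subrr.
have g0 : g 0 = 0 by rewrite -{1}[0](subrr 0) (zmod_morphism_linear lg) subrr.
rewrite [x]tensor_sum /sweedler; elim: (repr x) => [|p s IH].
  by rewrite !big_nil f0 g0.
rewrite big_cons.
have := lf 1 (pure p.1 p.2) (\sum_(p <- s) pure p.1 p.2).
have := lg 1 (pure p.1 p.2) (\sum_(p <- s) pure p.1 p.2).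
by rewrite !scale1r => -> ->; rewrite fg IH.
Qed.

End Tensor.

Arguments pure {k V W} & v w.
Arguments sweedler {k V W U}.

Notation "V ⊗ W" := (tensor V%type W%type) : type_scope.
Notation "v ⊗ w" := (pure v w) : ring_scope.
Notation "\sw_( u ⊗ v <- x ) F" := (sweedler x (fun u v => F)) : ring_scope.

Lemma sweedler_linear_arg (k : fieldType) (V W U U' : lmodType k)
    (F : U' -> V -> W -> U) (x : V ⊗ W) :
  (forall v w, linear (fun u => F u v w)) -> linear (fun u => sweedler x (F u)).
Proof.
move=> Flin c u u'; rewrite scaler_sumr -big_split /=.
by apply: eq_bigr => p _; rewrite Flin.
Qed.

(* Unital associative algebras over k, the zero algebra included.  MathComp's
   [algType] requires 1 != 0, and none of its structures joins [pzRingType] and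
   [lmodType], so the multiplication is part of the mixin and the [pzRingType]
   instance is derived from it. *)
HB.mixin Record isPzAlgebra (k : fieldType) A of GRing.Lmodule k A := {
  alg_one : A;
  alg_mul : A -> A -> A;
  alg_mulA : associative alg_mul;
  alg_mul1 : left_id alg_one alg_mul;
  alg_mulr1 : right_id alg_one alg_mul;
  alg_mul_bilinear : bilinear_for *:%R *:%R alg_mul
}.

#[short(type="pzAlgType")]
HB.structure Definition PzAlgebra (k : fieldType) :=
  {A of GRing.Lmodule k A & isPzAlgebra k A}.

Section PzAlgebraRing.
Variables (k : fieldType) (A : pzAlgType k).

Lemma alg_mulDl : left_distributive (@alg_mul k A) +%R.
Proof.
by move=> x y z; have := (@alg_mul_bilinear k A).1 z 1 x y; rewrite /= !scale1r.
Qed.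

Lemma alg_mulDr : right_distributive (@alg_mul k A) +%R.
Proof.
by move=> x y z; have := (@alg_mul_bilinear k A).2 x 1 y z; rewrite /= !scale1r.
Qed.

HB.instance Definition _ := GRing.Zmodule_isPzRing.Build (PzAlgebra.sort A)
  alg_mulA alg_mul1 alg_mulr1 alg_mulDl alg_mulDr.
End PzAlgebraRing.

Section PzAlgebraTheory.
Variables (k : fieldType) (A : pzAlgType k).

Lemma alg_mulE (x y : A) : alg_mul x y = x * y. Proof. by []. Qed.

Lemma alg_oneE : alg_one = 1 :> A. Proof. by []. Qed.

Lemma pzmul_linearl (y : A) : linear (fun x : A => x * y : A).
Proof. exact: alg_mul_bilinear.1. Qed.

Lemma pzmul_linearr (x : A) : linear (fun y : A => x * y : A).
Proof. exact: alg_mul_bilinear.2. Qed.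

Lemma scale_mull (c : k) (x y : A) : c *: (x * y) = (c *: x) * y.
Proof. by have := pzmul_linearl y c x 0; rewrite mul0r !addr0. Qed.

Lemma scale_mulr (c : k) (x y : A) : c *: (x * y) = x * (c *: y).
Proof. by have := pzmul_linearr x c y 0; rewrite mulr0 !addr0. Qed.

End PzAlgebraTheory.

Section TensorAlgebra.
Variables (k : fieldType) (A B : pzAlgType k).

Definition tens_one : A ⊗ B := 1 ⊗ 1.
Definition tens_mul (x y : A ⊗ B) : A ⊗ B :=
  \sw_(a ⊗ b <- x) \sw_(a' ⊗ b' <- y) a * a' ⊗ b * b'.

Let mul_pure (a : A) (b : B) (a' : A) (b' : B) : A ⊗ B := a * a' ⊗ b * b'.

Let mul_pure_bilinr a b : bilinear_for *:%R *:%R (mul_pure a b).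
Proof.
split=> [b' c x x'|a' c y y']; rewrite /mul_pure /=.
  by rewrite pzmul_linearr (pure_bilinear _ _).1.
by rewrite pzmul_linearr (pure_bilinear _ _).2.
Qed.

Let mul_pure_bilinl y :
  bilinear_for *:%R *:%R (fun a b => \sw_(a' ⊗ b' <- y) mul_pure a b a' b').
Proof.
split=> [b|a].
  apply: (@sweedler_linear_arg _ _ _ _ _ (fun a => mul_pure a b)) => a' b' c x x'.
  by rewrite /mul_pure pzmul_linearl (pure_bilinear _ _).1.
apply: (@sweedler_linear_arg _ _ _ _ _ (fun b => mul_pure a b)) => a' b' c x x'.
by rewrite /mul_pure pzmul_linearl (pure_bilinear _ _).2.
Qed.

Lemma tens_mul_linearl y : linear (fun x => tens_mul x y).
Proof. exact: sweedler_linear (mul_pure_bilinl y). Qed.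

Lemma tens_mul_linearr x : linear (tens_mul x).
Proof.
by move=> c y y'; rewrite /tens_mul scaler_sumr -big_split /=;
   apply: eq_bigr => p _; apply: sweedler_linear (mul_pure_bilinr _ _) _ _ _.
Qed.

Lemma tens_mul_pure a b a' b' :
  tens_mul (a ⊗ b) (a' ⊗ b') = a * a' ⊗ b * b'.
Proof.
by rewrite /tens_mul (sweedler_pure (mul_pure_bilinl _))
   (sweedler_pure (mul_pure_bilinr _ _)).
Qed.

Lemma tens_mulA : associative tens_mul.
Proof.
move=> x y z; move: x; apply: tensor_ext => [|c u v|a b].
- exact: tens_mul_linearl.
- by rewrite !tens_mul_linearl.
move: y; apply: tensor_ext => [c u v|c u v|a' b'].
- by rewrite tens_mul_linearl tens_mul_linearr.
- by rewrite tens_mul_linearr tens_mul_linearl.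
move: z; apply: tensor_ext => [c u v||a'' b''].
- by rewrite !tens_mul_linearr.
- exact: tens_mul_linearr.
by rewrite !tens_mul_pure !mulrA.
Qed.

Lemma tens_mul1 : left_id tens_one tens_mul.
Proof.
apply: tensor_ext => [|c u v|a b] //; first exact: tens_mul_linearr.
by rewrite tens_mul_pure !mul1r.
Qed.

Lemma tens_mulr1 : right_id tens_one tens_mul.
Proof.
apply: tensor_ext => [|c u v|a b] //; first exact: tens_mul_linearl.
by rewrite tens_mul_pure !mulr1.
Qed.

Lemma tens_mul_bilinear : bilinear_for *:%R *:%R tens_mul.
Proof. by split; [apply: tens_mul_linearl|apply: tens_mul_linearr]. Qed.

HB.instance Definition _ := isPzAlgebra.Build k (tensor A B)
  tens_mulA tens_mul1 tens_mulr1 tens_mul_bilinear.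

HB.instance Definition _ := GRing.Zmodule_isPzRing.Build (tensor A B)
  tens_mulA tens_mul1 tens_mulr1 (@alg_mulDl k (tensor A B)) (@alg_mulDr k (tensor A B)).

Lemma mul_pureE a b a' b' :
  (a ⊗ b : A ⊗ B) * (a' ⊗ b') = a * a' ⊗ b * b'.
Proof. exact: tens_mul_pure. Qed.

End TensorAlgebra.

HB.mixin Record isCoalgebra (k : fieldType) C of GRing.Lmodule k C := {
  comul : C -> C ⊗ C;
  counit : C -> k;
  comul_linear : linear comul;
  counit_linear : scalar counit;
  comulA : forall c : C,
    \sw_(c1 ⊗ c2 <- comul c) \sw_(c11 ⊗ c12 <- comul c1) c11 ⊗ (c12 ⊗ c2) =
    \sw_(c1 ⊗ c2 <- comul c) \sw_(c21 ⊗ c22 <- comul c2) c1 ⊗ (c21 ⊗ c22);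
  counitl : forall c : C, \sw_(c1 ⊗ c2 <- comul c) counit c1 *: c2 = c;
  counitr : forall c : C, \sw_(c1 ⊗ c2 <- comul c) counit c2 *: c1 = c
}.

#[short(type="coalgType")]
HB.structure Definition Coalgebra (k : fieldType) :=
  {C of GRing.Lmodule k C & isCoalgebra k C}.

HB.instance Definition _ (k : fieldType) (C : coalgType k) :=
  GRing.isLinear.Build k C (C ⊗ C)%type *:%R (@comul k C) comul_linear.

HB.instance Definition _ (k : fieldType) (C : coalgType k) :=
  GRing.isLinear.Build k C k *%R (@counit k C) counit_linear.

HB.mixin Record isHopfAlgebra (k : fieldType) H
    of PzAlgebra k H & Coalgebra k H := {
  comul1 : comul (alg_one : H) = alg_one ⊗ alg_one;
  comulM : forall g h : H, comul (alg_mul g h) = comul g * comul h;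
  counit1 : counit (alg_one : H) = 1 :> k;
  counitM : forall g h : H, counit (alg_mul g h) = counit g * counit h :> k;
  antipode : H -> H;
  antipode_linear : linear antipode;
  antipodel : forall h : H,
    \sw_(h1 ⊗ h2 <- comul h) alg_mul (antipode h1) h2 = (counit h : k) *: alg_one;
  antipoder : forall h : H,
    \sw_(h1 ⊗ h2 <- comul h) alg_mul h1 (antipode h2) = (counit h : k) *: alg_one
}.

#[short(type="hopfAlgType")]
HB.structure Definition HopfAlgebra (k : fieldType) :=
  {H of PzAlgebra k H & Coalgebra k H & isHopfAlgebra k H}.

HB.instance Definition _ (k : fieldType) (H : hopfAlgType k) :=
  GRing.Zmodule_isPzRing.Build (HopfAlgebra.sort H)
    alg_mulA alg_mul1 alg_mulr1 (@alg_mulDl k H) (@alg_mulDr k H).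

HB.instance Definition _ (k : fieldType) (H : hopfAlgType k) :=
  GRing.isLinear.Build k H H *:%R (@antipode k H) antipode_linear.

HB.mixin Record isComoduleAlgebra (k : fieldType) (H : hopfAlgType k) A
    of PzAlgebra k A := {
  coact : A -> A ⊗ H;
  coact_linear : linear coact;
  coact1 : coact alg_one = alg_one ⊗ 1;
  coactM : forall a b : A, coact (alg_mul a b) = coact a * coact b;
  coactA : forall a : A,
    \sw_(a0 ⊗ a1 <- coact a) \sw_(a00 ⊗ a01 <- coact a0) a00 ⊗ (a01 ⊗ a1) =
    \sw_(a0 ⊗ a1 <- coact a) \sw_(a11 ⊗ a12 <- comul a1) a0 ⊗ (a11 ⊗ a12);
  coact_counit : forall a : A,
    \sw_(a0 ⊗ a1 <- coact a) (counit a1 : k) *: a0 = a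
}.

#[short(type="comodAlgType")]
HB.structure Definition ComoduleAlgebra (k : fieldType) (H : hopfAlgType k) :=
  {A of PzAlgebra k A & isComoduleAlgebra k H A}.

HB.instance Definition _ (k : fieldType) (H : hopfAlgType k)
    (A : comodAlgType H) :=
  GRing.Zmodule_isPzRing.Build (ComoduleAlgebra.sort A)
    alg_mulA alg_mul1 alg_mulr1 (@alg_mulDl k A) (@alg_mulDr k A).

HB.instance Definition _ (k : fieldType) (H : hopfAlgType k)
    (A : comodAlgType H) :=
  GRing.isLinear.Build k A (A ⊗ H)%type *:%R (@coact k H A) coact_linear.

Section Cowreath.
Local Open Scope classical_set_scope.
Local Open Scope ring_scope.
Variables (k : fieldType) (H : hopfAlgType k) (A : comodAlgType H).

(* The inverse of the antipode when the latter is bijective ([antipodeK],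
   [antipodeVK]); otherwise an arbitrary choice of preimages. *)
Definition antipodeV (h : H) : H := xget 0 [set g : H | antipode g = h].

Lemma antipodeK : bijective (@antipode k H) -> cancel (@antipode k H) antipodeV.
Proof.
move=> bijS h; rewrite /antipodeV; case: xgetP => [g _ /(bij_inj bijS) //|noh].
by case: (noh h).
Qed.

Lemma antipodeVK : bijective (@antipode k H) -> cancel antipodeV (@antipode k H).
Proof.
move=> bijS h; have [g _ gK] := bijS.
by apply: (@xgetPex _ 0 [set g : H | antipode g = h]); exists (g h); apply: gK.
Qed.

(* H^op has the same underlying space and comultiplication as H, and every
   product below is taken in A ⊗ H with the ordinary product of H, so
   A ⊗ H^op is represented by A ⊗ H. *)

(* [psi h x] is psi(h ⊗ x), with values in (A ⊗ H^op) ⊗ H. *)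
Definition psi (h : H) (x : A ⊗ H) : (A ⊗ H) ⊗ H :=
  \sw_(a ⊗ l <- x) \sw_(a0 ⊗ a1 <- coact a) \sw_(l1 ⊗ l2 <- comul l)
    (a0 ⊗ l1) ⊗ (l2 * h * a1).

Record is_casimir (B : H ⊗ H -> A ⊗ H) : Prop := {
  casimir_linear : linear B;
  casimir_mul : forall (a : A) (g h h' : H),
    \sw_(a0 ⊗ a12 <- coact a) \sw_(a1 ⊗ a2 <- comul a12)
    \sw_(g1 ⊗ g23 <- comul g) \sw_(g2 ⊗ g3 <- comul g23)
      (a0 ⊗ 1) * B (g2 * h * a1 ⊗ g3 * h' * a2) * (1 ⊗ g1) =
    (1 ⊗ g) * B (h ⊗ h') * (a ⊗ 1);
  casimir_comul : forall h h' : H,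
    \sw_(h1 ⊗ h2 <- comul h) psi h1 (B (h2 ⊗ h')) =
    \sw_(h'1 ⊗ h'2 <- comul h') B (h ⊗ h'1) ⊗ h'2
}.

Definition is_normalized (B : H ⊗ H -> A ⊗ H) : Prop :=
  forall h : H,
    \sw_(h1 ⊗ h2 <- comul h) B (h1 ⊗ h2) =
    (counit h : k) *: ((1 : A) ⊗ (1 : H)).

Record is_integral (T : H -> A ⊗ H) : Prop := {
  integral_linear : linear T;
  integral_comul : forall h : H,
    \sw_(h1 ⊗ h2 <- comul h) psi h1 (T h2) = T h ⊗ 1;
  integral_mul : forall (a : A) (h : H),
    \sw_(a0 ⊗ a123 <- coact a) \sw_(a1 ⊗ a23 <- comul a123)
    \sw_(a2 ⊗ a3 <- comul a23)
      (a0 ⊗ 1) * T (antipodeV a2 * h * a1) * (1 ⊗ antipodeV a3) =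
    \sw_(a0 ⊗ a1 <- coact a) (1 ⊗ antipodeV a1) * T h * (a0 ⊗ 1)
}.

Definition is_total (T : H -> A ⊗ H) : Prop := T 1 = 1 ⊗ 1.

Definition Casim : set (H ⊗ H -> A ⊗ H) := [set B | is_casimir B].
Definition Casim_norm : set (H ⊗ H -> A ⊗ H) :=
  [set B | is_casimir B /\ is_normalized B].
Definition integrals : set (H -> A ⊗ H) := [set T | is_integral T].
Definition total_integrals : set (H -> A ⊗ H) :=
  [set T | is_integral T /\ is_total T].

Definition Phi (B : H ⊗ H -> A ⊗ H) (h : H) : A ⊗ H := B (h ⊗ 1).

End Cowreath.

Arguments Casim {k H} A.
Arguments Casim_norm {k H} A.
Arguments integrals {k H} A.
Arguments total_integrals {k H} A.
Arguments Phi {k H A} B h.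

(* Main.v *)
From HB Require Import structures.
Require Import Defs.
From mathcomp Require Import all_boot all_order all_algebra.
From mathcomp Require Import boolp classical_sets functions.
Import GRing.Theory.
Set Implicit Arguments.
Unset Strict Implicit.
Unset Printing Implicit Defensive.
Local Open Scope ring_scope.

(** H acts on the linear maps F : H -> A ⊗ H by
      (g · F)(x) = (1 ⊗ g3) F(S^-1(g1) x) (1 ⊗ S^-1(g2)),
    and the inverse of Phi sends T to B(h ⊗ h') = (h' · T)(h).  The Casimir
    condition with a = 1 forces this formula: it lets 1 ⊗ h'3 pass through B,
    after which all antipodes cancel.  Conversely, the Casimir condition for
    this B splits into a part in g, which holds for the action on any F, and a
    part in a, which is the integral condition at a0 multiplied on the left by
    1 ⊗ a1. *)

(** * Linearity of expressions built from tensors, products and structure maps *)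

Section Linearity.
Variables (k : fieldType) (U V W X : lmodType k).

Lemma linear_comp (f : V -> W) (g : U -> V) :
  linear f -> linear g -> linear (fun x => f (g x)).
Proof. by move=> lf lg c x y; rewrite lg lf. Qed.

Lemma linear_id : linear (fun x : U => x).
Proof. by []. Qed.

Lemma linear_purel (f : U -> V) (w : W) : linear f -> linear (fun x => f x ⊗ w).
Proof. by move=> lf c x y; rewrite lf (pure_bilinear V W).1. Qed.

Lemma linear_purer (f : U -> W) (v : V) : linear f -> linear (fun x => v ⊗ f x).
Proof. by move=> lf c x y; rewrite lf (pure_bilinear V W).2. Qed.

Lemma linear_scalel (C : coalgType k) (f : U -> C) (w : W) :
  linear f -> linear (fun x => counit (f x) *: w).
Proof. by move=> lf c x y; rewrite lf counit_linear scalerDl scalerA. Qed.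

Lemma linear_scaler (f : U -> V) (c : k) : linear f -> linear (fun x => c *: f x).
Proof. by move=> lf d x y; rewrite lf scalerDr !scalerA mulrC. Qed.

Lemma linear_mull (A : pzAlgType k) (f : U -> A) (a : A) :
  linear f -> linear (fun x => f x * a : A).
Proof. by move=> lf c x y; rewrite lf pzmul_linearl. Qed.

Lemma linear_mulr (A : pzAlgType k) (f : U -> A) (a : A) :
  linear f -> linear (fun x => a * f x : A).
Proof. by move=> lf c x y; rewrite lf pzmul_linearr. Qed.

(** The variable sits in the tensor being expanded, so bilinearity of [F] is what makes the sum
    independent of the chosen representative. *)
Lemma linear_sweedlerl (F : V -> W -> X) (f : U -> V ⊗ W) :
  (forall w, linear (F^~ w)) -> (forall v, linear (F v)) -> linear f ->
  linear (fun x => sweedler (f x) F).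
Proof.
move=> Fl Fr lf c x y; rewrite lf.
by apply: sweedler_linear; split=> z; [apply: Fl|apply: Fr].
Qed.

Lemma linear_sweedlerr (t : V ⊗ W) (F : U -> V -> W -> X) :
  (forall v w, linear (fun u => F u v w)) -> linear (fun u => sweedler t (F u)).
Proof. exact: sweedler_linear_arg. Qed.

Lemma linear_comul (C : coalgType k) (f : U -> C) :
  linear f -> linear (fun x => comul (f x)).
Proof. by move=> lf c x y; rewrite lf comul_linear. Qed.

Lemma linear_coact (H : hopfAlgType k) (A : comodAlgType H) (f : U -> A) :
  linear f -> linear (fun x => coact (f x)).
Proof. by move=> lf c x y; rewrite lf coact_linear. Qed.

Lemma linear_antipode (H : hopfAlgType k) (f : U -> H) :
  linear f -> linear (fun x => antipode (f x)).
Proof. by move=> lf c x y; rewrite lf antipode_linear. Qed.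

End Linearity.

(* The bare [comul], [coact], ... clauses are needed because unification
   eta-reduces the functions it finds. *)
Ltac lin :=
  intros; cbv beta;
  first [assumption | match goal with K : _ |- _ => exact: K end |
  match goal with
  | |- GRing.linear_for _ (fun x => x) => apply: linear_id
  | |- GRing.linear_for _ (fun x => sweedler _ _) =>
      first [apply: linear_sweedlerr; lin | apply: linear_sweedlerl; lin]
  | |- GRing.linear_for _ (fun x => _ * _) =>
      first [apply: linear_mull; lin | apply: linear_mulr; lin]
  | |- GRing.linear_for _ (fun x => _ ⊗ _) =>
      first [apply: linear_purel; lin | apply: linear_purer; lin]
  | |- GRing.linear_for _ (fun x => _ *: _) =>
      first [apply: linear_scaler; lin | apply: linear_scalel; lin]
  | |- GRing.linear_for _ (fun x => comul _) => apply: linear_comul; lin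
  | |- GRing.linear_for _ (fun x => coact _) => apply: linear_coact; lin
  | |- GRing.linear_for _ (fun x => antipode _) => apply: linear_antipode; lin
  | |- GRing.linear_for _ (@comul _ _) => exact: comul_linear
  | |- GRing.linear_for _ (@coact _ _ _) => exact: coact_linear
  | |- GRing.linear_for _ (@antipode _ _) => exact: antipode_linear
  | |- GRing.linear_for _ (pure _) => apply: (pure_bilinear _ _).2
  | |- GRing.linear_for _ ( *%R _) => apply: linear_mulr; exact: linear_id
  | |- GRing.linear_for _ (fun x => ?g (@?f x)) =>
      match goal with
      | K : _ |- _ => apply: (@linear_comp _ _ _ _ g f); [exact: K | lin]
      end
  | |- GRing.linear_for _ (fun x => ?g (@?f x) ?c) =>
      match goal with
      | K : _ |- _ => apply: (@linear_comp _ _ _ _ (fun y => g y c) f);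
        [exact: K | lin]
      end
  end].

(** * Calculus of Sweedler sums *)

Section Sw.
Variable (k : fieldType).
Implicit Types (V W U : lmodType k).

Lemma linear_sw V W U U' (f : U -> U') (x : V ⊗ W) F : linear f ->
  f (sweedler x F) = sweedler x (fun u v => f (F u v)).
Proof.
move=> lf; pose g : {linear U -> U'} :=
  HB.pack f (GRing.isLinear.Build _ _ _ _ f lf).
by rewrite -[f]/(g : U -> U') [LHS]linear_sum.
Qed.

(** Both sides are finite double sums over the same fixed representatives of [x] and [y], so only
    the order of summation changes. *)
Lemma sw_swap V W V' W' (U : nmodType) (x : V ⊗ W) (y : V' ⊗ W')
    (F : V -> W -> V' -> W' -> U) :
  \sw_(a ⊗ b <- x) \sw_(c ⊗ d <- y) F a b c d =
  \sw_(c ⊗ d <- y) \sw_(a ⊗ b <- x) F a b c d.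
Proof. exact: exchange_big. Qed.

(** The representative chosen for the inner sum need not be assembled from those of its terms;
    bilinearity of [G] makes the expansion linear in the tensor. *)
Lemma sw_sw V W V' W' U (x : V ⊗ W) (F : V -> W -> V' ⊗ W') (G : V' -> W' -> U) :
  (forall w, linear (G^~ w)) -> (forall v, linear (G v)) ->
  sweedler (sweedler x F) G = \sw_(a ⊗ b <- x) sweedler (F a b) G.
Proof.
move=> Gl Gr; apply: (@linear_sw _ _ _ _ (fun y => sweedler y G)).
apply: linear_sweedlerl => //; exact: linear_id.
Qed.

Lemma sw_pure V W U (v : V) (w : W) (G : V -> W -> U) :
  (forall w, linear (G^~ w)) -> (forall v, linear (G v)) ->
  sweedler (v ⊗ w) G = G v w.
Proof. by move=> Gl Gr; apply: sweedler_pure; split=> z; [apply: Gl|apply: Gr]. Qed.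

Lemma mulr_sw V W (R : pzAlgType k) (t : R) (x : V ⊗ W) (f : V -> W -> R) :
  t * sweedler x f = \sw_(u ⊗ v <- x) t * f u v.
Proof. by apply: linear_sw; lin. Qed.

Lemma mull_sw V W (R : pzAlgType k) (t : R) (x : V ⊗ W) (f : V -> W -> R) :
  sweedler x f * t = \sw_(u ⊗ v <- x) f u v * t.
Proof. by apply: (linear_sw (f := fun y : R => y * t)); lin. Qed.

Lemma tens_mulE (A B : pzAlgType k) (x y : A ⊗ B) :
  x * y = \sw_(a ⊗ b <- x) \sw_(a' ⊗ b' <- y) (a * a') ⊗ (b * b').
Proof. by []. Qed.

(** The trilinear [F] factors through the triple tensor product, and the induced linear map carries
    the axiom [comulA] to this identity. *)
Lemma coassoc (C : coalgType k) U (F : C -> C -> C -> U) (c : C) :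
  (forall y z, linear (fun x => F x y z)) ->
  (forall x z, linear (fun y => F x y z)) -> (forall x y, linear (F x y)) ->
  \sw_(x ⊗ y <- comul c) \sw_(u ⊗ v <- comul x) F u v y =
  \sw_(x ⊗ y <- comul c) \sw_(u ⊗ v <- comul y) F x u v.
Proof.
move=> F1 F2 F3.
have /= := congr1 (fun t => \sw_(a ⊗ t' <- t) \sw_(u ⊗ v <- t') F a u v) (comulA c).
rewrite !sw_sw; try by lin.
rewrite (eq_sweedler _ (g := fun x y => \sw_(u ⊗ v <- comul x) F u v y)); last first.
  move=> x y; rewrite sw_sw; [|lin..]; apply: eq_sweedler => u v.
  by rewrite !sw_pure //; lin.
move=> ->; apply: eq_sweedler => x y; rewrite sw_sw; [|lin..].
by apply: eq_sweedler => u v; rewrite !sw_pure //; lin.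
Qed.

Lemma coassoc4 (C : coalgType k) U (F : C -> C -> C -> C -> U) (c : C) :
  (forall y z w, linear (fun x => F x y z w)) ->
  (forall x z w, linear (fun y => F x y z w)) ->
  (forall x y w, linear (fun z => F x y z w)) -> (forall x y z, linear (F x y z)) ->
  \sw_(b ⊗ w <- comul c) \sw_(x ⊗ q <- comul b) \sw_(y ⊗ z <- comul q) F x y z w =
  \sw_(x ⊗ q <- comul c) \sw_(y ⊗ r <- comul q) \sw_(z ⊗ w <- comul r) F x y z w.
Proof.
move=> F1 F2 F3 F4.
rewrite (coassoc (F := fun x q w => \sw_(y ⊗ z <- comul q) F x y z w)); [|lin..].
by apply: eq_sweedler => x q; rewrite coassoc //; lin.
Qed.

Lemma coact_coassoc (H : hopfAlgType k) (A : comodAlgType H) U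
    (F : A -> H -> H -> U) (a : A) :
  (forall y z, linear (fun x => F x y z)) ->
  (forall x z, linear (fun y => F x y z)) -> (forall x y, linear (F x y)) ->
  \sw_(x ⊗ y <- coact a) \sw_(u ⊗ v <- coact x) F u v y =
  \sw_(x ⊗ y <- coact a) \sw_(u ⊗ v <- comul y) F x u v.
Proof.
move=> F1 F2 F3.
have /= := congr1 (fun t => \sw_(a ⊗ t' <- t) \sw_(u ⊗ v <- t') F a u v) (coactA a).
rewrite !sw_sw; try by lin.
rewrite (eq_sweedler _ (g := fun x y => \sw_(u ⊗ v <- coact x) F u v y)); last first.
  move=> x y; rewrite sw_sw; [|lin..]; apply: eq_sweedler => u v.
  by rewrite !sw_pure //; lin.
move=> ->; apply: eq_sweedler => x y; rewrite sw_sw; [|lin..].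
by apply: eq_sweedler => u v; rewrite !sw_pure //; lin.
Qed.

Lemma sw_counitl (C : coalgType k) U (f : C -> U) (c : C) : linear f ->
  \sw_(x ⊗ y <- comul c) counit x *: f y = f c.
Proof.
move=> lf; rewrite -{2}[c]counitl linear_sw //.
by apply: eq_sweedler => x y; rewrite (scalable_linear lf).
Qed.

Lemma sw_counitr (C : coalgType k) U (f : C -> U) (c : C) : linear f ->
  \sw_(x ⊗ y <- comul c) counit y *: f x = f c.
Proof.
move=> lf; rewrite -{2}[c]counitr linear_sw //.
by apply: eq_sweedler => x y; rewrite (scalable_linear lf).
Qed.

Lemma sw_coact_counit (H : hopfAlgType k) (A : comodAlgType H) U (f : A -> U) (a : A) :
  linear f -> \sw_(x ⊗ y <- coact a) counit y *: f x = f a.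
Proof.
move=> lf; rewrite -{2}[a]coact_counit linear_sw //.
by apply: eq_sweedler => x y; rewrite (scalable_linear lf).
Qed.

(** Common shape of the identities for the antipode and its inverse, in which two adjacent Sweedler
    legs cancel; cancellation inside longer sums is then proved once for all four. *)
Definition contraction (C : coalgType k) V (m : C -> C -> V) (e : V) :=
  [/\ forall y, linear (m^~ y), forall x, linear (m x) &
      forall c, \sw_(x ⊗ y <- comul c) m x y = counit c *: e].

Lemma contractE (C : coalgType k) V U (m : C -> C -> V) (e : V) (f : V -> U) (c : C) :
  contraction m e -> linear f ->
  \sw_(x ⊗ y <- comul c) f (m x y) = counit c *: f e.
Proof.
by case=> _ _ mE lf; rewrite -linear_sw // mE (scalable_linear lf).
Qed.

(** Coassociativity makes the first two of three legs the legs of one element; they contract to [e]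
    times a counit, which the third leg absorbs. *)
Lemma contract12 (C : coalgType k) V U (m : C -> C -> V) (e : V) (G : V -> C -> U)
    (c : C) :
  contraction m e -> (forall y, linear (G^~ y)) -> (forall x, linear (G x)) ->
  \sw_(x ⊗ r <- comul c) \sw_(y ⊗ z <- comul r) G (m x y) z = G e c.
Proof.
move=> mc Gl Gr; have [ml mr _] := mc.
have Gm1 y z : linear (fun x => G (m x y) z).
  by apply: (@linear_comp _ _ _ _ (G^~ z) (m^~ y)).
have Gm2 x z : linear (fun y => G (m x y) z).
  by apply: (@linear_comp _ _ _ _ (G^~ z) (m x)).
rewrite -(coassoc (F := fun x y z => G (m x y) z)) //.
rewrite -(sw_counitl c (Gr e)); apply: eq_sweedler => x z.
exact: (contractE x mc (Gl z)).
Qed.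

(** * The antipode reverses products and coproducts *)

Section Antipode.
Variable H : hopfAlgType k.

Lemma sw_comulM U (F : H -> H -> U) (g h : H) :
  (forall w, linear (F^~ w)) -> (forall v, linear (F v)) ->
  \sw_(x ⊗ y <- comul (g * h)) F x y =
  \sw_(g1 ⊗ g2 <- comul g) \sw_(h1 ⊗ h2 <- comul h) F (g1 * h1) (g2 * h2).
Proof.
move=> Fl Fr; rewrite comulM tens_mulE sw_sw //.
apply: eq_sweedler => g1 g2; rewrite sw_sw //.
by apply: eq_sweedler => h1 h2; rewrite sw_pure.
Qed.

Lemma contraction_antipodel :
  contraction (fun x y : H => antipode x * y) 1.
Proof. by split; [lin|lin|exact: antipodel]. Qed.

Lemma contraction_antipoder :
  contraction (fun x y : H => x * antipode y) 1.
Proof. by split; [lin|lin|exact: antipoder]. Qed.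

Lemma antipode1 : antipode (1 : H) = 1.
Proof.
case: contraction_antipodel => _ _ /(_ 1).
rewrite [comul (1 : H)]comul1 sw_pure; [|lin..].
by rewrite [counit (1 : H)]counit1 scale1r [_ * _]mulr1.
Qed.

(* Both sides are convolution inverses of the multiplication H ⊗ H -> H. *)
Lemma antipodeM (g h : H) : antipode (g * h) = antipode h * antipode g.
Proof.
transitivity (\sw_(g1 ⊗ r <- comul g) \sw_(g2 ⊗ g3 <- comul r)
  \sw_(h1 ⊗ s <- comul h) \sw_(h2 ⊗ h3 <- comul s)
  antipode (g1 * h1) * (g2 * h2) * (antipode h3 * antipode g3)).
  (* In this bracketing [h2 * antipode h3] and [g2 * antipode g3] contract, which leaves
     [antipode (g * h)]. *)
  transitivity (\sw_(g1 ⊗ r <- comul g) \sw_(g2 ⊗ g3 <- comul r)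
    antipode (g1 * h) * (g2 * antipode g3)).
    under eq_sweedler => g1 r.
      rewrite (contractE (f := fun x : H =>
        antipode (g1 * h) * x) r contraction_antipoder); [|lin].
      over.
    by rewrite (sw_counitr (f := fun x : H =>
      antipode (x * h) * 1)); [rewrite mulr1|lin].
  apply: eq_sweedler => g1 r; apply: eq_sweedler => g2 g3.
  transitivity (\sw_(h1 ⊗ s <- comul h) \sw_(h2 ⊗ h3 <- comul s)
    antipode (g1 * h1) * (g2 * (h2 * antipode h3) * antipode g3)).
    under eq_sweedler => h1 s.
      rewrite (contractE (f := fun x : H =>
        antipode (g1 * h1) * (g2 * x * antipode g3)) s contraction_antipoder); [|lin].
      over.
    rewrite (sw_counitr (f := fun x : H =>
      antipode (g1 * x) * (g2 * 1 * antipode g3))); [|lin].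
    by rewrite mulr1.
  by apply: eq_sweedler => h1 s; apply: eq_sweedler => h2 h3; rewrite !mulrA.
transitivity (\sw_(g1 ⊗ r <- comul g) \sw_(g2 ⊗ g3 <- comul r)
  \sw_(h' ⊗ h3 <- comul h) \sw_(h1 ⊗ h2 <- comul h')
  antipode (g1 * h1) * (g2 * h2) * (antipode h3 * antipode g3)).
  apply: eq_sweedler => g1 r; apply: eq_sweedler => g2 g3.
  by rewrite (coassoc (F := fun h1 h2 h3 : H =>
    antipode (g1 * h1) * (g2 * h2) * (antipode h3 * antipode g3))); [|lin..].
rewrite -(coassoc (F := fun g1 g2 g3 : H =>
  \sw_(h' ⊗ h3 <- comul h) \sw_(h1 ⊗ h2 <- comul h')
  antipode (g1 * h1) * (g2 * h2) * (antipode h3 * antipode g3))); [|lin..].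
(* In the other bracketing the first two legs of [g] and [h] combine to the legs of [g' * h'], where
   the left antipode identity applies. *)
under eq_sweedler => g' g3.
  rewrite sw_swap.
  under eq_sweedler => h' h3.
    rewrite -(sw_comulM (F := fun x y : H =>
      antipode x * y * (antipode h3 * antipode g3))); [|lin..].
    rewrite (contractE (f := fun x : H =>
      x * (antipode h3 * antipode g3)) _ contraction_antipodel); [|lin].
    rewrite (counitM g' h') mul1r -scalerA.
    over.
  rewrite -(linear_sw (f := fun x : H => counit g' *: x)); [|lin].
  rewrite (sw_counitl (f := fun x : H => antipode x * antipode g3)); [|lin].
  over.
by rewrite (sw_counitl (f := fun x : H => antipode h * antipode x)); [|lin].
Qed.

(* Both sides are convolution inverses of [comul]. *)
Lemma comul_antipode (h : H) :
  comul (antipode h) = \sw_(h1 ⊗ h2 <- comul h) antipode h2 ⊗ antipode h1.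
Proof.
transitivity (\sw_(h1 ⊗ r <- comul h) \sw_(h2 ⊗ s <- comul r)
  comul (antipode h1) * comul h2 *
  \sw_(h3 ⊗ h4 <- comul s) (antipode h4 ⊗ antipode h3)); last first.
  transitivity (\sw_(h1 ⊗ r <- comul h) \sw_(h2 ⊗ s <- comul r)
    comul (antipode h1 * h2) * \sw_(h3 ⊗ h4 <- comul s) (antipode h4 ⊗ antipode h3)).
    apply: eq_sweedler => h1 r; apply: eq_sweedler => h2 s.
    by rewrite [in RHS](comulM (antipode h1) h2).
  rewrite (contract12 (G := fun x s : H => comul x *
    \sw_(h3 ⊗ h4 <- comul s) (antipode h4 ⊗ antipode h3)) _ contraction_antipodel); [|lin..].
  by rewrite [comul (1 : H)]comul1 mul1r.
rewrite -{1}(sw_counitr h (f := fun x : H => comul (antipode x))); [|lin].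
apply: eq_sweedler => h1 r.
transitivity (comul (antipode h1) * \sw_(h2 ⊗ s <- comul r)
   comul h2 * \sw_(h3 ⊗ h4 <- comul s) (antipode h4 ⊗ antipode h3)); last first.
  by rewrite linear_sw; [|lin]; apply: eq_sweedler => h2 s; rewrite mulrA.
(* The candidate is a right convolution inverse of [comul]: the inner pair [y * antipode h3]
   contracts first, then the outer pair [x * antipode h4]. *)
suff -> : \sw_(h2 ⊗ s <- comul r)
   comul h2 * (\sw_(h3 ⊗ h4 <- comul s) (antipode h4 ⊗ antipode h3)) =
   (counit r : k) *: ((1 : H) ⊗ (1 : H)).
  by rewrite -scale_mulr mulr1.
transitivity (\sw_(h2 ⊗ s <- comul r) \sw_(x ⊗ y <- comul h2) \sw_(h3 ⊗ h4 <- comul s)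
   (x * antipode h4) ⊗ (y * antipode h3)).
  apply: eq_sweedler => h2 s; rewrite [LHS]tens_mulE.
  apply: eq_sweedler => x y; rewrite sw_sw; [|lin..].
  by apply: eq_sweedler => h3 h4; rewrite sw_pure //; lin.
rewrite (coassoc (F := fun x y s : H =>
  \sw_(h3 ⊗ h4 <- comul s) (x * antipode h4) ⊗ (y * antipode h3))); [|lin..].
under eq_sweedler => x q.
  rewrite (contract12 (G := fun z h4 : H =>
    (x * antipode h4) ⊗ z) _ contraction_antipoder); [|lin..].
  over.
by rewrite (contractE (f := fun z : H =>
  z ⊗ (1 : H)) _ contraction_antipoder); [|lin].
Qed.

(** * The inverse antipode *)

Hypothesis bijS : bijective (@antipode k H).
Local Notation S' := (@antipodeV k H).

Lemma antipodeV_linear : linear S'.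
Proof.
move=> c x y; apply: (bij_inj bijS).
by rewrite antipode_linear !antipodeVK.
Qed.

Lemma antipodeV1 : S' 1 = 1.
Proof. by rewrite -{1}antipode1 antipodeK. Qed.

Lemma antipodeVM g h : S' (g * h) = S' h * S' g.
Proof. by apply: (bij_inj bijS); rewrite antipodeM !antipodeVK. Qed.

(** As [h] is [antipode (S' h)], [comul_antipode] at [S' h] describes [comul h], and [S'] cancels
    [antipode] in each leg. *)
Lemma sw_comul_antipodeV U (F : H -> H -> U) (h : H) :
  (forall w, linear (F^~ w)) -> (forall v, linear (F v)) ->
  \sw_(x ⊗ y <- comul (S' h)) F x y = \sw_(h1 ⊗ h2 <- comul h) F (S' h2) (S' h1).
Proof.
move=> Fl Fr; have Sl := antipodeV_linear.
rewrite -[in RHS](antipodeVK bijS h) comul_antipode sw_sw; last first.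
- move=> v; exact: (linear_comp (f := F^~ (S' v))).
- by move=> v; apply: linear_comp.
apply: eq_sweedler => x y; rewrite sw_pure ?antipodeK // => v.
  by apply: linear_comp.
exact: (linear_comp (f := F^~ (S' v))).
Qed.

(** The antipode is injective and reverses products, so it turns [S' y * x] into [antipode x * y]
    and reduces the claim to the left antipode identity. *)
Lemma contraction_antipodeVl : contraction (fun x y : H => S' y * x) 1.
Proof.
have Sl := antipodeV_linear.
split; [by lin..|move=> c]; apply: (bij_inj bijS).
rewrite linear_sw; [|lin]; rewrite (scalable_linear (@antipode_linear k H)) antipode1.
case: contraction_antipodel => _ _ /(_ c) /= mE; apply: etrans mE.
by apply: eq_sweedler => x y; rewrite antipodeM antipodeVK.
Qed.

(** The antipode turns [y * S' x] into [x * antipode y], and the right antipode identity applies. *)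
Lemma contraction_antipodeVr : contraction (fun x y : H => y * S' x) 1.
Proof.
have Sl := antipodeV_linear.
split; [by lin..|move=> c]; apply: (bij_inj bijS).
rewrite linear_sw; [|lin]; rewrite (scalable_linear (@antipode_linear k H)) antipode1.
case: contraction_antipoder => _ _ /(_ c) /= mE; apply: etrans mE.
by apply: eq_sweedler => x y; rewrite antipodeM antipodeVK.
Qed.

End Antipode.
End Sw.

(** * The action of [H] on linear maps [H -> A ⊗ H] *)

Section Main.
Variables (k : fieldType) (H : hopfAlgType k) (A : comodAlgType H).
Hypothesis bijS : bijective (@antipode k H).
Local Notation S' := (@antipodeV k H).
Implicit Types (F T : H -> A ⊗ H) (B : H ⊗ H -> A ⊗ H).

Let S'_lin : linear S' := antipodeV_linear bijS.
Let contrVl := contraction_antipodeVl bijS.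
Let contrVr := contraction_antipodeVr bijS.
Local Notation psi := (@psi k H A).

Definition iact (g : H) F (x : H) : A ⊗ H :=
  \sw_(g1 ⊗ r <- comul g) \sw_(g2 ⊗ g3 <- comul r)
    (1 ⊗ g3) * F (S' g1 * x) * (1 ⊗ S' g2).

Lemma iactE F g x : iact g F x = \sw_(g1 ⊗ r <- comul g) \sw_(g2 ⊗ g3 <- comul r)
    (1 ⊗ g3) * F (S' g1 * x) * (1 ⊗ S' g2).
Proof. by []. Qed.

Lemma iact_linearl F x : linear F -> linear (fun g => iact g F x).
Proof. by move=> Fl; rewrite /iact; lin. Qed.

Lemma iact_linearr F g : linear F -> linear (iact g F).
Proof. by move=> Fl; rewrite /iact; lin. Qed.

Lemma iact1 F x : linear F -> iact 1 F x = F x.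
Proof.
move=> Fl; rewrite /iact [comul (1 : H)]comul1 sw_pure; [|lin..].
rewrite [comul (1 : H)]comul1 sw_pure; [|lin..].
by rewrite antipodeV1 // mul1r [_ * F x]mul1r [F x * _]mulr1.
Qed.

Lemma mul1_pure (g h : H) : ((1 : A) ⊗ g) * (1 ⊗ h) = 1 ⊗ (g * h).
Proof. by rewrite mul_pureE mulr1. Qed.

Lemma pure1C (a : A) (g : H) : (a ⊗ 1) * (1 ⊗ g) = (1 ⊗ g) * (a ⊗ 1).
Proof. by rewrite !mul_pureE !mulr1 !mul1r. Qed.

(** [comul] is multiplicative, and [S'] reverses products just as nesting the two actions does, both
    in the argument of [F] and in the right factor. *)
Lemma iactM F g h x : linear F -> iact (g * h) F x = iact g (iact h F) x.
Proof.
move=> Fl; rewrite /iact sw_comulM; [|lin..].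
apply: eq_sweedler => g1 r.
under eq_sweedler => h1 s.
  rewrite sw_comulM; [|lin..].
  over.
rewrite sw_swap; apply: eq_sweedler => g2 g3.
rewrite mulr_sw mull_sw.
apply: eq_sweedler => h1 s.
rewrite mulr_sw mull_sw.
apply: eq_sweedler => h2 h3.
by rewrite !antipodeVM // -!mul1_pure !mulrA.
Qed.

(** The part in [g] of the Casimir condition. Expanding the action gives five legs of [g]:
    [S' g3 * g2] contracts first, then [S' g4 * g1], leaving [1 ⊗ g5]. *)
Lemma iact_mul F g x : linear F ->
  \sw_(g1 ⊗ r <- comul g) \sw_(g2 ⊗ g3 <- comul r) iact g3 F (g2 * x) * (1 ⊗ g1) =
  (1 ⊗ g) * F x.
Proof.
move=> Fl.
transitivity (\sw_(g1 ⊗ r <- comul g) \sw_(v ⊗ w <- comul r)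
  (1 ⊗ w) * F x * (1 ⊗ (S' v * g1))).
  apply: eq_sweedler => g1 r.
  transitivity (\sw_(g2 ⊗ g3 <- comul r) \sw_(u ⊗ r' <- comul g3)
    \sw_(v ⊗ w <- comul r') (1 ⊗ w) * F (S' u * g2 * x) * (1 ⊗ (S' v * g1))).
    apply: eq_sweedler => g2 g3; rewrite mull_sw.
    apply: eq_sweedler => u r'; rewrite mull_sw.
    by apply: eq_sweedler => v w; rewrite -!mul1_pure !mulrA.
  rewrite (contract12 (G := fun (z r' : H) => \sw_(v ⊗ w <- comul r')
     (1 ⊗ w) * F (z * x) * (1 ⊗ (S' v * g1))) _ contrVl); [|lin..].
  by rewrite mul1r.
rewrite (contract12 (G := fun (z w : H) =>
  (1 ⊗ w) * F x * (1 ⊗ z)) _ contrVl); [|lin..].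
by rewrite mulr1.
Qed.

(** The part in [a]. In the integral condition at [a0], the extra factor [1 ⊗ a1] passes [a0 ⊗ 1] on
    one side and completes the action on [T]; on the other side it cancels against [S']. *)
Lemma iact_integral T a x : is_integral T ->
  \sw_(a0 ⊗ b <- coact a) \sw_(a1 ⊗ a2 <- comul b) (a0 ⊗ 1) * iact a2 T (x * a1) =
  T x * (a ⊗ 1).
Proof.
case=> Tl _ Tm.
transitivity (\sw_(a0 ⊗ w <- coact a) (1 ⊗ w) *
  \sw_(a0' ⊗ b <- coact a0) \sw_(a1 ⊗ c <- comul b) \sw_(a2 ⊗ a3 <- comul c)
    (a0' ⊗ 1) * T (S' a2 * x * a1) * (1 ⊗ S' a3)).
  transitivity (\sw_(a0 ⊗ w <- coact a)
  \sw_(a0' ⊗ b <- coact a0) \sw_(a1 ⊗ c <- comul b) \sw_(a2 ⊗ a3 <- comul c)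
    (1 ⊗ w) * ((a0' ⊗ 1) * T (S' a2 * x * a1) * (1 ⊗ S' a3))); last first.
    apply: eq_sweedler => a0 w; rewrite mulr_sw.
    apply: eq_sweedler => a0' b; rewrite mulr_sw.
    by apply: eq_sweedler => a1 c; rewrite mulr_sw.
  rewrite (coact_coassoc (F := fun a0 b w =>
    \sw_(a1 ⊗ c <- comul b) \sw_(a2 ⊗ a3 <- comul c)
    (1 ⊗ w) * ((a0 ⊗ 1) * T (S' a2 * x * a1) * (1 ⊗ S' a3)))); [|lin..].
  apply: eq_sweedler => a0 c.
  rewrite (coassoc4 (F := fun a1 a2 a3 w : H =>
    (1 ⊗ w) * ((a0 ⊗ 1) * T (S' a2 * x * a1) * (1 ⊗ S' a3)))); [|lin..].
  apply: eq_sweedler => a1 q; rewrite mulr_sw.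
  apply: eq_sweedler => a2 r; rewrite mulr_sw.
  by apply: eq_sweedler => a3 w; rewrite !mulrA pure1C.
transitivity (\sw_(a0 ⊗ w <- coact a) \sw_(a0' ⊗ b <- coact a0)
   (1 ⊗ (w * S' b)) * T x * (a0' ⊗ 1)).
  apply: eq_sweedler => a0 w; rewrite Tm mulr_sw.
  by apply: eq_sweedler => a0' b; rewrite -mul1_pure !mulrA.
rewrite (coact_coassoc (F := fun a0 b w =>
  (1 ⊗ (w * S' b)) * T x * (a0 ⊗ 1))); [|lin..].
under eq_sweedler => a0 c.
  rewrite (contractE (f := fun z : H => (1 ⊗ z) * T x * (a0 ⊗ 1)) _ contrVr); [|lin].
  rewrite mul1r.
  over.
by rewrite (sw_coact_counit (f := fun a0 => T x * (a0 ⊗ 1))); [|lin].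
Qed.

(** * Compatibility of the action with [psi] *)

Lemma psi_linearl x : linear (fun h => psi h x).
Proof. by rewrite /psi; lin. Qed.

Lemma psi_linearr (h : H) : linear (psi h).
Proof. by rewrite /psi; lin. Qed.

(** [psi y] puts the second leg of the [H] factor directly to the left of [y], so its last part [r2]
    is absorbed into the argument of [psi], while [l2] stays outside. *)
Lemma psi_mul_pure (l m r y : H) (a : A) :
  psi y (a ⊗ (l * m * r)) =
  \sw_(l1 ⊗ l2 <- comul l) \sw_(r1 ⊗ r2 <- comul r)
    ((1 ⊗ l1) ⊗ l2) * psi (r2 * y) (a ⊗ m) * ((1 ⊗ r1) ⊗ 1).
Proof.
rewrite /psi sw_pure; [|lin..].
transitivity (\sw_(l1 ⊗ l2 <- comul l) \sw_(r1 ⊗ r2 <- comul r)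
 \sw_(a0 ⊗ a1 <- coact a) \sw_(m1 ⊗ m2 <- comul m)
   (a0 ⊗ (l1 * m1 * r1)) ⊗ (l2 * m2 * r2 * y * a1)).
  transitivity (\sw_(a0 ⊗ a1 <- coact a) \sw_(l1 ⊗ l2 <- comul l)
   \sw_(m1 ⊗ m2 <- comul m) \sw_(r1 ⊗ r2 <- comul r)
   (a0 ⊗ (l1 * m1 * r1)) ⊗ (l2 * m2 * r2 * y * a1)).
    apply: eq_sweedler => a0 a1.
    by rewrite sw_comulM; [|lin..]; rewrite sw_comulM; [|lin..].
  rewrite sw_swap; apply: eq_sweedler => l1 l2.
  rewrite [RHS]sw_swap; apply: eq_sweedler => a0 a1.
  by rewrite sw_swap.
apply: eq_sweedler => l1 l2; apply: eq_sweedler => r1 r2.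
rewrite sw_pure; [|lin..].
rewrite mulr_sw mull_sw.
apply: eq_sweedler => a0 a1.
rewrite mulr_sw mull_sw.
apply: eq_sweedler => m1 m2.
by rewrite !mul_pureE mulr1 mul1r mulr1 !mulrA.
Qed.

Lemma psi_mul (l r y : H) (t : A ⊗ H) :
  psi y ((1 ⊗ l) * t * (1 ⊗ r)) =
  \sw_(l1 ⊗ l2 <- comul l) \sw_(r1 ⊗ r2 <- comul r)
    ((1 ⊗ l1) ⊗ l2) * psi (r2 * y) t * ((1 ⊗ r1) ⊗ 1).
Proof.
have pl := psi_linearl; have pr := psi_linearr.
move: t; apply: tensor_ext => [||a m]; [lin|lin|].
by rewrite -psi_mul_pure !mul_pureE mul1r mulr1.
Qed.

(** The second Casimir condition for [casimir_of T]. By [psi_mul] a leg of [S' u] enters the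
    argument of [psi], where it pairs with [S' p] inside [T] so that the integral condition
    applies. *)
Lemma psi_iact T h h' : is_integral T ->
  \sw_(h1 ⊗ h2 <- comul h) psi h1 (iact h' T h2) =
  \sw_(h'1 ⊗ h'2 <- comul h') iact h'1 T h ⊗ h'2.
Proof.
case=> Tl Tc _; have pl := psi_linearl; have pr := psi_linearr.
(* The integral condition at [S' p * h], expanded with [S'] reversing the legs of [p]. *)
have psi_antipodeV p : \sw_(p1 ⊗ p2 <- comul p) \sw_(h1 ⊗ h2 <- comul h)
    psi (S' p2 * h1) (T (S' p1 * h2)) = T (S' p * h) ⊗ 1.
  by rewrite -Tc sw_comulM; [|lin..]; rewrite sw_comul_antipodeV //; lin.
transitivity (\sw_(p ⊗ q <- comul h') \sw_(u ⊗ v <- comul q)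
  \sw_(h1 ⊗ h2 <- comul h) psi h1 ((1 ⊗ v) * T (S' p * h2) * (1 ⊗ S' u))).
  transitivity (\sw_(h1 ⊗ h2 <- comul h) \sw_(p ⊗ q <- comul h') \sw_(u ⊗ v <- comul q)
    psi h1 ((1 ⊗ v) * T (S' p * h2) * (1 ⊗ S' u))).
    apply: eq_sweedler => h1 h2; rewrite linear_sw; [|lin].
    by apply: eq_sweedler => p q; rewrite linear_sw; [|lin].
  rewrite sw_swap; apply: eq_sweedler => p q; exact: sw_swap.
transitivity (\sw_(p ⊗ q <- comul h') \sw_(u ⊗ v <- comul q)
  \sw_(u1 ⊗ u2 <- comul u) \sw_(v1 ⊗ v2 <- comul v)
   ((1 ⊗ v1) ⊗ v2) *
   (\sw_(h1 ⊗ h2 <- comul h) psi (S' u1 * h1) (T (S' p * h2))) * ((1 ⊗ S' u2) ⊗ 1)).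
  apply: eq_sweedler => p q; apply: eq_sweedler => u v.
  transitivity (\sw_(h1 ⊗ h2 <- comul h)
    \sw_(u1 ⊗ u2 <- comul u) \sw_(v1 ⊗ v2 <- comul v)
     ((1 ⊗ v1) ⊗ v2) * psi (S' u1 * h1) (T (S' p * h2)) * ((1 ⊗ S' u2) ⊗ 1)).
    apply: eq_sweedler => h1 h2; rewrite psi_mul sw_swap.
    by rewrite sw_comul_antipodeV //; lin.
  rewrite sw_swap; apply: eq_sweedler => u1 u2.
  rewrite sw_swap; apply: eq_sweedler => v1 v2.
  by rewrite mulr_sw mull_sw.
transitivity (\sw_(p ⊗ q <- comul h') \sw_(u1 ⊗ s <- comul q)
  \sw_(u2 ⊗ v <- comul s) \sw_(v1 ⊗ v2 <- comul v)
   ((1 ⊗ v1) ⊗ v2) *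
   (\sw_(h1 ⊗ h2 <- comul h) psi (S' u1 * h1) (T (S' p * h2))) * ((1 ⊗ S' u2) ⊗ 1)).
  apply: eq_sweedler => p q.
  by rewrite (coassoc (F := fun u1 u2 v : H => \sw_(v1 ⊗ v2 <- comul v)
   ((1 ⊗ v1) ⊗ v2) *
   (\sw_(h1 ⊗ h2 <- comul h) psi (S' u1 * h1) (T (S' p * h2))) *
   ((1 ⊗ S' u2) ⊗ 1))); [|lin..].
(* Coassociativity makes [p] and [u1] the two legs of a single element, as [psi_antipodeV]
   requires. *)
rewrite -(coassoc (F := fun p u1 s : H =>
  \sw_(u2 ⊗ v <- comul s) \sw_(v1 ⊗ v2 <- comul v)
   ((1 ⊗ v1) ⊗ v2) *
   (\sw_(h1 ⊗ h2 <- comul h) psi (S' u1 * h1) (T (S' p * h2))) *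
   ((1 ⊗ S' u2) ⊗ 1))); [|lin..].
transitivity (\sw_(p ⊗ s <- comul h') \sw_(u ⊗ v <- comul s) \sw_(v1 ⊗ v2 <- comul v)
  ((1 ⊗ v1) * T (S' p * h) * (1 ⊗ S' u)) ⊗ v2).
  apply: eq_sweedler => p s; rewrite sw_swap.
  apply: eq_sweedler => u v; rewrite sw_swap.
  apply: eq_sweedler => v1 v2; rewrite -mull_sw -mulr_sw psi_antipodeV.
  by rewrite !mul_pureE !mulr1.
rewrite -(coassoc4 (F := fun p u v1 v2 : H =>
  ((1 ⊗ v1) * T (S' p * h) * (1 ⊗ S' u)) ⊗ v2)); [|lin..].
apply: eq_sweedler => h1 h2; rewrite (linear_sw (f := fun y => y ⊗ h2)); [|lin].
by apply: eq_sweedler => p q; rewrite (linear_sw (f := fun y => y ⊗ h2)); [|lin].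
Qed.

(** * From integrals to Casimir morphisms *)

Definition casimir_of T (z : H ⊗ H) : A ⊗ H := \sw_(h ⊗ h' <- z) iact h' T h.

Lemma casimir_of_pure T h h' : linear T -> casimir_of T (h ⊗ h') = iact h' T h.
Proof.
move=> Tl.
have il x : linear (fun g => iact g T x) by exact: iact_linearl.
have ir g : linear (iact g T) by exact: iact_linearr.
by rewrite /casimir_of sw_pure; [|lin..].
Qed.

Lemma casimir_of_casimir T : is_integral T -> is_casimir (casimir_of T).
Proof.
move=> iT; have Tl := integral_linear iT.
have il x : linear (fun g => iact g T x) by exact: iact_linearl.
have ir g : linear (iact g T) by exact: iact_linearr.
split.
- by rewrite /casimir_of; lin.
- move=> a g h h'.
  (* The part in [g]: [iact_mul] for the map [iact (h' * a2) T], where [iactM] merges [g3] into the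
     acting element. *)
  transitivity (\sw_(a0 ⊗ b <- coact a) \sw_(a1 ⊗ a2 <- comul b)
     (a0 ⊗ 1) * ((1 ⊗ g) * iact (h' * a2) T (h * a1))).
    apply: eq_sweedler => a0 b; apply: eq_sweedler => a1 a2.
    rewrite -(iact_mul (F := iact (h' * a2) T)) //.
    rewrite mulr_sw; apply: eq_sweedler => g1 r.
    rewrite mulr_sw; apply: eq_sweedler => g2 g3.
    rewrite casimir_of_pure // -!mulrA; congr (_ * (_ * _)).
    by rewrite iactM // mulrA.
  (* The part in [a]: [iact_integral] is used under the action of [h'], at the points [S' p * h]. *)
  transitivity ((1 ⊗ g) * iact h' (fun x => T x * (a ⊗ 1)) h).
    rewrite [in RHS]iactE.
    transitivity ((1 ⊗ g) * \sw_(p ⊗ r <- comul h') \sw_(u ⊗ v <- comul r)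
      \sw_(a0 ⊗ b <- coact a) \sw_(a1 ⊗ a2 <- comul b)
        (1 ⊗ v) * ((a0 ⊗ 1) * iact a2 T (S' p * h * a1)) * (1 ⊗ S' u)).
      rewrite mulr_sw.
      under [RHS]eq_sweedler => p r.
        rewrite mulr_sw.
        under eq_sweedler => u v.
          rewrite mulr_sw.
          under eq_sweedler => a0 b do rewrite mulr_sw.
          over.
        rewrite sw_swap.
        under eq_sweedler => a0 b do rewrite sw_swap.
        over.
      rewrite [RHS]sw_swap; apply: eq_sweedler => a0 b.
      rewrite [RHS]sw_swap; apply: eq_sweedler => a1 a2.
      rewrite iactM // [iact h' _ _]iactE mulrA mulr_sw; apply: eq_sweedler => p r.
      rewrite mulr_sw; apply: eq_sweedler => u v.
      by rewrite !mulrA pure1C -(mulrA (1 ⊗ g)) pure1C !mulrA.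
    congr (_ * _); apply: eq_sweedler => p r; apply: eq_sweedler => u v.
    rewrite -iact_integral // mulr_sw mull_sw.
    apply: eq_sweedler => a0 b; rewrite mulr_sw mull_sw.
    by apply: eq_sweedler => a1 a2.
  (* [a ⊗ 1] commutes with every [1 ⊗ S' u], so it comes out of the action on the right. *)
  rewrite casimir_of_pure // -mulrA; congr (_ * _).
  rewrite /iact mull_sw; apply: eq_sweedler => p r.
  rewrite mull_sw; apply: eq_sweedler => u v.
  by rewrite -!mulrA pure1C.
- move=> h h'; under eq_sweedler => h1 h2 do rewrite casimir_of_pure //.
  rewrite psi_iact //; apply: eq_sweedler => h1 h2.
  by rewrite casimir_of_pure.
Qed.

(** * From Casimir morphisms to integrals *)

Lemma casimir_mul1 B (g x y : H) : is_casimir B ->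
  \sw_(g1 ⊗ r <- comul g) \sw_(g2 ⊗ g3 <- comul r)
    B ((g2 * x) ⊗ (g3 * y)) * (1 ⊗ g1) = (1 ⊗ g) * B (x ⊗ y).
Proof.
case=> Bl Bm _; have := Bm 1 g x y.
rewrite [coact (1 : A)]coact1 sw_pure; [|lin..].
rewrite [comul (1 : H)]comul1 sw_pure; [|lin..].
rewrite [_ * (1 ⊗ 1)]mulr1 => <-.
apply: eq_sweedler => g1 r; apply: eq_sweedler => g2 g3.
by rewrite [_ * B _]mul1r !mulr1.
Qed.

(** Once [casimir_mul1] has moved the left factor through [B], [g1 * S' u] contracts, then
    [g2 * S' p]. Thus [B] is recovered from [Phi B]. *)
Lemma iact_Phi B h h' : is_casimir B -> iact h' (Phi B) h = B (h ⊗ h').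
Proof.
move=> cB; have Bl := casimir_linear cB; rewrite /iact /Phi.
transitivity (\sw_(p ⊗ q <- comul h') \sw_(g2 ⊗ g3 <- comul q)
   B ((g2 * S' p * h) ⊗ g3)).
  apply: eq_sweedler => p q.
  transitivity (\sw_(u ⊗ v <- comul q) \sw_(g1 ⊗ r <- comul v) \sw_(g2 ⊗ g3 <- comul r)
    B ((g2 * S' p * h) ⊗ g3) * (1 ⊗ (g1 * S' u))).
    apply: eq_sweedler => u v; rewrite -casimir_mul1 // mull_sw.
    apply: eq_sweedler => g1 r; rewrite mull_sw.
    by apply: eq_sweedler => g2 g3; rewrite mulr1 -mul1_pure !mulrA.
  rewrite (contract12 (G := fun z r : H => \sw_(g2 ⊗ g3 <- comul r)
    B ((g2 * S' p * h) ⊗ g3) * (1 ⊗ z)) _ contrVr); [|lin..].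
  by apply: eq_sweedler => g2 g3; rewrite [LHS]mulr1.
rewrite (contract12 (G := fun z g3 : H => B ((z * h) ⊗ g3)) _ contrVr); [|lin..].
by rewrite mul1r.
Qed.

Lemma Phi_integral B : is_casimir B -> is_integral (Phi B).
Proof.
move=> cB; have [Bl Bm Bc] := cB; split.
- by rewrite /Phi; lin.
- by move=> h; rewrite /Phi Bc [comul (1 : H)]comul1 sw_pure; [|lin..].
move=> a h; rewrite /Phi; symmetry.
transitivity (\sw_(a0 ⊗ w <- coact a) \sw_(a0' ⊗ b <- coact a0) \sw_(p ⊗ q <- comul b)
  \sw_(w1 ⊗ w2 <- comul w) \sw_(w11 ⊗ w12 <- comul w1)
   (a0' ⊗ 1) * B ((S' w12 * h * p) ⊗ (S' w11 * q)) * (1 ⊗ S' w2)).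
  (* The Casimir condition at [a0], with [S' w] for [g] and 1 as second argument of [B]; [S'] then
     reverses the legs of [w]. *)
  apply: eq_sweedler => a0 w; rewrite -Bm.
  apply: eq_sweedler => a0' b; apply: eq_sweedler => p q.
  rewrite sw_comul_antipodeV //; [|lin..].
  apply: eq_sweedler => w1 w2; rewrite sw_comul_antipodeV //; [|lin..].
  by apply: eq_sweedler => w11 w12; rewrite mulr1.
rewrite (coact_coassoc (F := fun a0 b w => \sw_(p ⊗ q <- comul b)
  \sw_(w1 ⊗ w2 <- comul w) \sw_(w11 ⊗ w12 <- comul w1)
   (a0 ⊗ 1) * B ((S' w12 * h * p) ⊗ (S' w11 * q)) * (1 ⊗ S' w2))); [|lin..].
apply: eq_sweedler => a0 c.
rewrite (coassoc (F := fun p q w : H =>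
  \sw_(w1 ⊗ w2 <- comul w) \sw_(w11 ⊗ w12 <- comul w1)
   (a0 ⊗ 1) * B ((S' w12 * h * p) ⊗ (S' w11 * q)) * (1 ⊗ S' w2))); [|lin..].
apply: eq_sweedler => p s.
transitivity (\sw_(q ⊗ w <- comul s) \sw_(w11 ⊗ x <- comul w) \sw_(w12 ⊗ w2 <- comul x)
   (a0 ⊗ 1) * B ((S' w12 * h * p) ⊗ (S' w11 * q)) * (1 ⊗ S' w2)).
  apply: eq_sweedler => q w.
  by rewrite (coassoc (F := fun w11 w12 w2 : H =>
   (a0 ⊗ 1) * B ((S' w12 * h * p) ⊗ (S' w11 * q)) * (1 ⊗ S' w2))); [|lin..].
(* [S' w11 * q] contracts to 1, so what remains are values of [Phi B]. *)
by rewrite (contract12 (G := fun z x : H => \sw_(w12 ⊗ w2 <- comul x)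
   (a0 ⊗ 1) * B ((S' w12 * h * p) ⊗ z) * (1 ⊗ S' w2)) _ contrVl); [|lin..].
Qed.

(** * Bijectivity, normalization and totality *)

Lemma Phi_casimir_of T : linear T -> Phi (casimir_of T) = T.
Proof.
by move=> Tl; apply: funext => h; rewrite /Phi casimir_of_pure // iact1.
Qed.

(** [iact_Phi] expresses [B] on pure tensors through [Phi B], and a linear map is determined by
    these values. *)
Lemma Phi_inj : {in Casim A &, injective (@Phi k H A)}.
Proof.
move=> B C /set_mem cB /set_mem cC BC; apply: funext.
apply: tensor_ext; [exact: casimir_linear cB|exact: casimir_linear cC|].
by move=> h h'; rewrite -!iact_Phi // BC.
Qed.

Lemma Phi_total B : is_casimir B -> is_normalized B -> Defs.is_total (Phi B).
Proof.
move=> /casimir_linear Bl /(_ 1); rewrite [comul (1 : H)]comul1 sw_pure; [|lin..].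
by rewrite [counit (1 : H)]counit1 scale1r.
Qed.

(** Among the four legs of [h], the first two contract to 1 inside [T]; since [T 1] is [1 ⊗ 1], the
    remaining pair [w * S' v] meets and contracts to the counit. *)
Lemma casimir_of_normalized T : is_integral T -> Defs.is_total T ->
  is_normalized (casimir_of T).
Proof.
move=> iT T1 h; have Tl := integral_linear iT.
under eq_sweedler => h1 h2 do rewrite casimir_of_pure // iactE.
rewrite (contract12 (G := fun z r : H => \sw_(v ⊗ w <- comul r)
  (1 ⊗ w) * T z * (1 ⊗ S' v)) _ contrVl); [|lin..].
rewrite T1.
transitivity (\sw_(v ⊗ w <- comul h) (1 : A) ⊗ (w * S' v)).
  by apply: eq_sweedler => v w; rewrite !mul_pureE !mulr1.
by rewrite (contractE (f := fun z : H => (1 : A) ⊗ z) _ contrVr); [|lin].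
Qed.

End Main.

Theorem theorem3p3 (k : fieldType) (H : hopfAlgType k) (A : comodAlgType H) :
  bijective (antipode : H -> H) ->
  set_bij (Casim A) (integrals A) Phi /\
  set_bij (Casim_norm A) (total_integrals A) Phi.
Proof.
move=> bijS; split; split.
- by move=> B; apply: Phi_integral.
- exact: Phi_inj.
- move=> T iT; exists (casimir_of T); first exact: casimir_of_casimir.
  exact/Phi_casimir_of/integral_linear.
- by move=> B [cB nB]; split; [apply: Phi_integral|apply: Phi_total].
- by move=> B C /set_mem[cB _] /set_mem[cC _]; apply: (Phi_inj bijS); apply/mem_set.
- move=> T [iT T1]; exists (casimir_of T); last exact/Phi_casimir_of/integral_linear.
  by split; [apply: casimir_of_casimir|apply: casimir_of_normalized].
Qed.
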